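(* Let $(U,D_U,m_U)$ and $(A,D_A,m_A)$ be sets with partial multiplications and with mutual actions $(\alpha,u)\mapsto\alpha\cdot u\in U$ and $(\alpha,u)\mapsto\alpha^u\in A$ defined on $H\subseteq A\times U$. Let $E\subseteq U\times A$ and assume: - $(\alpha\cdot u,\alpha^u)\in E$ whenever $(\alpha,u)\in H$; - $(u,\alpha)\in E$ and $(v,u)\in D_U$ imply $(vu,\alpha)\in E$; - $(u,\alpha)\in E$ and $(\alpha,\beta)\in D_A$ imply $(u,\alpha\beta)\in E$. Put on $E$ the partial multiplication $$(u,\alpha)(v,\beta)=(u(\alpha\cdot v),\ \alpha^v\beta),$$ where the left side is defined if and only if all of $(\alpha,v)\in H$, $(u,\alpha\cdot v)\in D_U$ and $(\alpha^v,\beta)\in D_A$ hold. Then the following hold. (viii) If $U$ and $A$ are both right cancellative and $(\alpha,u)\mapsto\alpha^u$ is an injective family (i.e. $\alpha^u=\beta^u$ implies $\alpha=\beta$), then the partial multiplication on $E$ is right cancellative. (ix) If $U$ and $A$ (semigroups) both have common right multiples, $H=A\times U$, and $(\alpha,u)\mapsto\alpha\cdot u$ is a surjective family (i.e. for each $\alpha\in A$ and $v\in U$ there is a $u\in U$ with $\alpha\cdot u=v$), then the partial multiplication on $E$ has common right multiples. (x) If $A$ and $U$ are semigroups, $H=A\times U$, and for all $\alpha,\beta\in A$, $u,v\in U$ the identities $(\alpha\beta)\cdot u=\alpha\cdot(\beta\cdot u)$, $(\alpha\beta)^u=\alpha^{\beta\cdot u}\beta^u$, $\alpha\cdot(uv)=(\alpha\cdot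 u)(\alpha^u\cdot v)$ and $\alpha^{uv}=(\alpha^u)^v$ hold, then the multiplication $(u,\alpha)(v,\beta)=(u(\alpha\cdot v),\alpha^v\beta)$ makes $E$ a semigroup.
   Context: A set with partial multiplication is a triple $(X,D,m)$ with $X$ a set, $D\subseteq X\times X$ and $m:D\to X$ a function; write $xy$ for $m(x,y)$ when $(x,y)\in D$. Mutual actions on $H$ are simply two functions $H\to U$, $(\alpha,u)\mapsto\alpha\cdot u$, and $H\to A$, $(\alpha,u)\mapsto\alpha^u$. Right cancellative: $xz=yz$ (both defined) always implies $x=y$. A semigroup is a set with an everywhere defined associative multiplication. Having common right multiples means that for every pair of elements $x,y$ there are $p,q$ with $xp=yq$ (both defined). *)

(* Defs.v *)
From mathcomp Require Import all_boot.
From mathcomp Require Import boolp classical_sets.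

Set Implicit Arguments.
Unset Strict Implicit.
Unset Printing Implicit Defensive.

Local Open Scope classical_set_scope.

(* A function on a subset [D] of [T] is a Rocq function on the subtype
   [set_type D] (the coercion of [D] to a type). Membership proofs are boolean,
   so the value does not depend on the proof that is supplied. *)
Definition value_at T S (D : set T) (f : D -> S) (x : T) (hx : x \in D) : S :=
  f (exist _ x hx).

Lemma in_full T (D : set T) (eD : D = setT) (x : T) : x \in D.
Proof. by rewrite eD in_setT. Qed.

Definition value_full T S (D : set T) (eD : D = setT) (f : D -> S) (x : T) : S :=
  value_at f (in_full eD x).

Record partialMul (X : Type) := PartialMul {
  pm_dom : set (X * X);
  pm_fun : pm_dom -> X
}.

Definition pm_mul X (m : partialMul X) (x y : X) (h : (x, y) \in pm_dom m) : X :=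
  value_at (@pm_fun X m) h.

Definition total_mul X (m : partialMul X) (e : pm_dom m = setT) (x y : X) : X :=
  value_full e (@pm_fun X m) (x, y).

Record is_semigroup X (m : partialMul X) : Prop := IsSemigroup {
  sg_total : pm_dom m = setT;
  sg_assoc : associative (total_mul sg_total)
}.

Definition sg_mul X (m : partialMul X) (s : is_semigroup m) : X -> X -> X :=
  total_mul (sg_total s).

Definition right_cancellative X (m : partialMul X) : Prop :=
  forall (x y z : X) (hx : (x, z) \in pm_dom m) (hy : (y, z) \in pm_dom m),
    pm_mul hx = pm_mul hy -> x = y.

Definition common_right_multiples X (m : partialMul X) : Prop :=
  forall x y : X, exists (p q : X)
    (hp : (x, p) \in pm_dom m) (hq : (y, q) \in pm_dom m),
    pm_mul hp = pm_mul hq.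

(* [act_dot] is (a, u) |-> a . u and [act_pow] is (a, u) |-> a ^ u. *)
Record mutualActions (U A : Type) := MutualActions {
  act_dom : set (A * U);
  act_dot : act_dom -> U;
  act_pow : act_dom -> A
}.

Section MutualActionsTheory.
Variables (U A : Type) (H : mutualActions U A).

Definition dot (a : A) (u : U) (h : (a, u) \in act_dom H) : U :=
  value_at (@act_dot U A H) h.
Definition pow (a : A) (u : U) (h : (a, u) \in act_dom H) : A :=
  value_at (@act_pow U A H) h.

Definition total_dot (e : act_dom H = setT) (a : A) (u : U) : U :=
  value_full e (@act_dot U A H) (a, u).
Definition total_pow (e : act_dom H = setT) (a : A) (u : U) : A :=
  value_full e (@act_pow U A H) (a, u).

Definition pow_injective : Prop :=
  forall (a b : A) (u : U)
    (ha : (a, u) \in act_dom H) (hb : (b, u) \in act_dom H),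
    pow ha = pow hb -> a = b.

Definition dot_surjective : Prop :=
  forall (a : A) (v : U), exists (u : U) (h : (a, u) \in act_dom H), dot h = v.

End MutualActionsTheory.

Section Product.
Variables (U A : Type) (mU : partialMul U) (mA : partialMul A).
Variables (H : mutualActions U A) (E : set (U * A)).

(* (u, a)(v, b) = (u (a . v), (a ^ v) b), with x = (u, a) and y = (v, b). *)
Record zs_defined (x y : U * A) : Prop := ZsDefined {
  zs_act : (x.2, y.1) \in act_dom H;
  zs_left : (x.1, dot zs_act) \in pm_dom mU;
  zs_right : (pow zs_act, y.2) \in pm_dom mA
}.

Definition zs_pair (x y : U * A) (d : zs_defined x y) : U * A :=
  (pm_mul (zs_left d), pm_mul (zs_right d)).

Hypothesis E_act : forall (a : A) (u : U) (h : (a, u) \in act_dom H),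
  (dot h, pow h) \in E.
Hypothesis E_mulU : forall (u v : U) (a : A) (h : (v, u) \in pm_dom mU),
  (u, a) \in E -> (pm_mul h, a) \in E.
Hypothesis E_mulA : forall (u : U) (a b : A) (h : (a, b) \in pm_dom mA),
  (u, a) \in E -> (u, pm_mul h) \in E.

Lemma zs_pair_in (x y : U * A) (d : zs_defined x y) : zs_pair d \in E.
Proof. exact: E_mulA (E_mulU _ (E_act (zs_act d))). Qed.

Definition zs_dom : set (E * E) := [set p | zs_defined (val p.1) (val p.2)].

Definition zs_fun (p : zs_dom) : E :=
  SigSub (zs_pair_in (set_mem (valP p))).

Definition zs_mul : partialMul E := PartialMul zs_fun.

End Product.

(* Main.v *)
Require Import Defs.
From mathcomp Require Import all_boot.
From mathcomp Require Import boolp classical_sets.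

Local Open Scope classical_set_scope.

Section ZappaSzep.
Variables (U A : Type) (mU : partialMul U) (mA : partialMul A).
Variables (H : mutualActions U A) (E : set (U * A)).
Hypothesis E_act : forall (a : A) (u : U) (h : (a, u) \in act_dom H),
  (dot h, pow h) \in E.
Hypothesis E_mulU : forall (u v : U) (a : A) (h : (v, u) \in pm_dom mU),
  (u, a) \in E -> (pm_mul h, a) \in E.
Hypothesis E_mulA : forall (u : U) (a b : A) (h : (a, b) \in pm_dom mA),
  (u, a) \in E -> (u, pm_mul h) \in E.

Let mE := zs_mul E_act E_mulU E_mulA.

Lemma zs_mul_domP (x y : E) :
  (x, y) \in pm_dom mE <-> zs_defined mU mA H (val x) (val y).
Proof. by split=> [/set_mem|d]; last exact: mem_set. Qed.

(** The domain of [mE] is a proposition, so by proof irrelevance the witness hidden in [h] may be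
    replaced by any convenient [d]. This lets later proofs choose the [d] they compute with. *)
Lemma val_zs_mul (x y : E) (h : (x, y) \in pm_dom mE)
    (d : zs_defined mU mA H (val x) (val y)) :
  val (pm_mul h) = zs_pair d.
Proof. by congr zs_pair; exact: Prop_irrelevance. Qed.
Arguments val_zs_mul {x y} h d.

(** The order of cancellation matters. The [A]-components give [a ^ w = b ^ w], hence [a = b] by
    injectivity; only then do the [U]-components [u (a . w)] and [v (b . w)] share their right
    factor. *)
Lemma zs_mul_right_cancellative :
  right_cancellative mU -> right_cancellative mA -> pow_injective H ->
  right_cancellative mE.
Proof.
move=> cU cA injH [[u a] xE] [[v b] yE] [[w c] zE] hx hy /(congr1 val).
have dx := (zs_mul_domP _ _).1 hx; have dy := (zs_mul_domP _ _).1 hy.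
rewrite (val_zs_mul hx dx) (val_zs_mul hy dy) /zs_pair => -[eU eA].
have eab : a = b by exact: injH (cA _ _ _ _ _ eA).
apply/val_inj => /=; subst b; congr pair.
(* Although [a] and [b] are now identified, the two values of [dot] still carry different domain
   proofs. [zs_left dx] is generalized first because its type depends on the proof being
   replaced. *)
move: (zs_left dx) eU; rewrite (Prop_irrelevance (zs_act dx) (zs_act dy)) => h.
exact: cU.
Qed.

(* To solve [x p = y q] in [E] one solves the [U]-component first, with [p.1]
   and [q.1] obtained by surjectivity. The second components must keep [p] and
   [q] in [E]: writing [p.1 = a . s], any right multiple of [a ^ s] will do. *)
Lemma zs_mul_common_right_multiples :
  is_semigroup mA ->
  common_right_multiples mU -> common_right_multiples mA ->
  dot_surjective H -> common_right_multiples mE.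
Proof.
move=> [tA assA] crmU crmA surj [[u a] xE] [[v b] yE].
have [p [q [hp [hq epq]]]] := crmU u v.
have [w [hw ew]] := surj a p; have [z [hz ez]] := surj b q.
have [s [hs es]] := surj a w; have [t [ht et]] := surj b z.
have inA k : k \in pm_dom mA by exact: in_full.
(* The second components of [P] and [Q] will be [(a ^ s) c] and [(b ^ t) c']. The products in [E]
   then have [A]-components [(a ^ w)((a ^ s) c)] and [(b ^ z)((b ^ t) c')], so [c] and [c'] must
   equalize the reassociated products. *)
have [c [c' [hc [hc' ecc]]]] :=
  crmA (pm_mul (inA (pow hw, pow hs))) (pm_mul (inA (pow hz, pow ht))).
have wE : (w, pm_mul (inA (pow hs, c))) \in E by rewrite -{1}es; exact/E_mulA/E_act.
have zE : (z, pm_mul (inA (pow ht, c'))) \in E by rewrite -{1}et; exact/E_mulA/E_act.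
have lw : (u, dot hw) \in pm_dom mU by rewrite ew.
have lz : (v, dot hz) \in pm_dom mU by rewrite ez.
pose X : E := exist (fun e => e \in E) _ xE.
pose Y : E := exist (fun e => e \in E) _ yE.
pose P : E := exist (fun e => e \in E) _ wE.
pose Q : E := exist (fun e => e \in E) _ zE.
pose dP := @ZsDefined _ _ mU mA H (val X) (val P) hw lw (inA _).
pose dQ := @ZsDefined _ _ mU mA H (val Y) (val Q) hz lz (inA _).
exists P, Q, ((zs_mul_domP X P).2 dP), ((zs_mul_domP Y Q).2 dQ).
apply/val_inj; rewrite (val_zs_mul _ dP) (val_zs_mul _ dQ); congr pair => /=.
  move: lw lz {dP dQ}; rewrite ew ez => lw lz.
  by rewrite (bool_irrelevance lw hp) (bool_irrelevance lz hq).
(* Passing to the total product removes the domain proofs, so that associativity can be used as a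
   rewrite rule. *)
have pmE k l (h : (k, l) \in pm_dom mA) : pm_mul h = total_mul tA k l.
  by congr pm_mul; exact: bool_irrelevance.
by move: ecc; rewrite !pmE !assA.
Qed.

(** Associativity is checked componentwise: [dU] and [dM] bring both [U]-components to products of
    [u], [a . v] and [(a ^ v) . (b . w)], while [pU] and [pM] bring both [A]-components to products
    of [(a ^ v) ^ (b . w)], [b ^ w] and [c]. *)
Lemma zs_mul_semigroup (sA : is_semigroup mA) (sU : is_semigroup mU)
    (eH : act_dom H = setT) :
  let mulA := sg_mul sA in
  let mulU := sg_mul sU in
  let d := total_dot eH in
  let p := total_pow eH in
  (forall (a b : A) (u : U), d (mulA a b) u = d a (d b u)) ->
  (forall (a b : A) (u : U), p (mulA a b) u = mulA (p a (d b u)) (p b u)) ->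
  (forall (a : A) (u v : U), d a (mulU u v) = mulU (d a u) (d (p a u) v)) ->
  (forall (a : A) (u v : U), p a (mulU u v) = p (p a u) v) ->
  is_semigroup mE.
Proof.
move=> mulA mulU d p dM pM dU pU.
have mulAA : associative mulA by exact: sg_assoc.
have mulUA : associative mulU by exact: sg_assoc.
(* Built from [in_full], exactly as the total operations are, so that [mulE] below holds by
   conversion once [val_zs_mul] is applied. *)
pose defd (x y : E) : zs_defined mU mA H (val x) (val y) :=
  @ZsDefined _ _ mU mA H (val x) (val y)
    (in_full eH _) (in_full (sg_total sU) _) (in_full (sg_total sA) _).
have tE : pm_dom mE = setT by apply/seteqP; split=> // -[x y] _; exact: defd.
have mulE (x y : E) : val (total_mul tE x y) =
    (mulU (val x).1 (d (val x).2 (val y).1),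
     mulA (p (val x).2 (val y).1) (val y).2).
  by rewrite (val_zs_mul _ (defd x y)).
exists tE; move=> x y z; apply/val_inj; rewrite !mulE /=.
by rewrite dU dM pU pM mulUA mulAA.
Qed.

End ZappaSzep.

Theorem lemma3p12 (U A : Type) (mU : partialMul U) (mA : partialMul A)
    (H : mutualActions U A) (E : set (U * A))
    (E_act : forall (a : A) (u : U) (h : (a, u) \in act_dom H),
       (dot h, pow h) \in E)
    (E_mulU : forall (u v : U) (a : A) (h : (v, u) \in pm_dom mU),
       (u, a) \in E -> (pm_mul h, a) \in E)
    (E_mulA : forall (u : U) (a b : A) (h : (a, b) \in pm_dom mA),
       (u, a) \in E -> (u, pm_mul h) \in E) :
  let mE := zs_mul E_act E_mulU E_mulA in
  [/\ (right_cancellative mU -> right_cancellative mA -> pow_injective H ->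
       right_cancellative mE),
      (is_semigroup mU -> is_semigroup mA ->
       common_right_multiples mU -> common_right_multiples mA ->
       act_dom H = setT -> dot_surjective H ->
       common_right_multiples mE)
    & (forall (sA : is_semigroup mA) (sU : is_semigroup mU)
         (eH : act_dom H = setT),
       let mulA := sg_mul sA in
       let mulU := sg_mul sU in
       let d := total_dot eH in
       let p := total_pow eH in
       (forall (a b : A) (u : U), d (mulA a b) u = d a (d b u)) ->
       (forall (a b : A) (u : U), p (mulA a b) u = mulA (p a (d b u)) (p b u)) ->
       (forall (a : A) (u v : U), d a (mulU u v) = mulU (d a u) (d (p a u) v)) ->
       (forall (a : A) (u v : U), p a (mulU u v) = p (p a u) v) ->
       is_semigroup mE)].
Proof.
split.
- exact: zs_mul_right_cancellative.
- by move=> _ sA crmU crmA _; exact: zs_mul_common_right_multiples.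
- exact: zs_mul_semigroup.
Qed.
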